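(* Let $M\cong\mathbb{Z}^2$ be a lattice of rank $2$ and let $P\subseteq\mathbb{R}\times M_{\mathbb{R}}$ be a lattice $3$-polytope (with respect to $\mathbb{Z}\times M$) of lattice width $2$ with $P\subseteq[-1,1]\times M_{\mathbb{R}}$ and $\dim F(P)=2$. Then $F(P)\subseteq\{0\}\times M_{\mathbb{R}}$ is a half-integral polygon.
   Context: $M_{\mathbb{R}}=M\otimes\mathbb{R}$. For a lattice $L$ with dual lattice $L^*=\mathrm{Hom}(L,\mathbb{Z})$, natural pairing $\langle\cdot,\cdot\rangle$, a polytope $Q\subseteq L_{\mathbb{R}}$ and $n\in L^*$, put $\mathrm{Min}_Q(n)=\min\{\langle x,n\rangle\mid x\in Q\}$. The Fine interior of $Q$ is $F(Q)=\{x\in L_{\mathbb{R}}\mid \langle x,n\rangle\ge\mathrm{Min}_Q(n)+1\ \forall n\in L^*\setminus\{0\}\}$. The lattice width of $Q$ is $\mathrm{lw}(Q)=\min\{-\mathrm{Min}_Q(-n)-\mathrm{Min}_Q(n)\mid n\in L^*\setminus\{0\}\}$. Here these notions are used with $L=\mathbb{Z}\times M$. A lattice $3$-polytope is a $3$-dimensional polytope whose vertices are lattice points. A polygon is half-integral if all its vertices lie in $\tfrac12L$. *)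

(* Defs.v *)
From HB Require Import structures.
From mathcomp Require Import all_boot all_order all_algebra.
From mathcomp Require Import all_classical all_reals.
Set Implicit Arguments.
Unset Strict Implicit.
Unset Printing Implicit Defensive.
Import Order.TTheory GRing.Theory Num.Theory.
Local Open Scope classical_set_scope.
Local Open Scope ring_scope.

Section Lattice.
Variables (R : realType) (E : vectType R).
Implicit Types (L Q : set E) (x y : E) (n : 'Hom(E, R^o)) (d : nat).

(* A lattice L of rank r is given inside its realification E = L (x) R, as the
   Z-span of an R-basis of E *)
Definition is_lattice (r : nat) (L : set E) : Prop :=
  exists2 b : r.-tuple E, basis_of fullv b & L = [set x | inIntSpan b x].

(* Hom(L, Z), each element being identified with its unique R-linear extension
   to E. *)
Definition dual_lattice L : set 'Hom(E, R^o) :=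
  [set n | forall x, L x -> (n x : R) \is a Num.int].

Definition half_lattice L : set E := [set x | L (x *+ 2)].

Definition conv_hull (k : nat) (p : 'I_k -> E) : set E :=
  [set x | exists a : 'I_k -> R,
     [/\ forall i, 0 <= a i, \sum_i a i = 1 & x = \sum_i a i *: p i]].

Definition polytope Q : Prop :=
  exists (k : nat) (p : 'I_k.+1 -> E), Q = conv_hull p.

Definition vertex Q x : Prop :=
  Q x /\ forall y z (t : R), Q y -> Q z -> 0 < t -> t < 1 ->
    x = t *: y + (1 - t) *: z -> y = x /\ z = x.

(* x0 + W is the affine hull of Q; in particular Q is nonempty. *)
Definition has_dim Q d : Prop :=
  exists (x0 : E) (W : {vspace E}),
    [/\ Q x0, \dim W = d, forall x, Q x -> x - x0 \in W &
        forall U : {vspace E}, (forall x, Q x -> x - x0 \in U) -> (W <= U)%VS].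

(* The infimum is attained for a polytope Q, as is the one in [lattice_width]
   when L is a lattice and Q a full-dimensional polytope. *)
Definition Min Q n : R := inf [set (n x : R) | x in Q].

Definition fine_interior L Q : set E :=
  [set x | forall n, dual_lattice L n -> n != 0 -> Min Q n + 1 <= n x].

Definition lattice_width L Q : R :=
  inf [set - Min Q (- n) - Min Q n | n in [set n | dual_lattice L n /\ n != 0]].

Definition lattice_polytope L Q d : Prop :=
  [/\ polytope Q, has_dim Q d & forall x, vertex Q x -> L x].

Definition half_integral_polygon L Q : Prop :=
  [/\ polytope Q, has_dim Q 2 & forall x, vertex Q x -> half_lattice L x].

End Lattice.

Definition Zset (R : realType) : set R^o := [set x | (x : R) \is a Num.int].

(* Main.v *)
Require Import Defs.
From HB Require Import structures.
From mathcomp Require Import all_boot all_order all_algebra.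
From mathcomp Require Import all_classical all_reals.
From mathcomp Require Import zify ring lra.
Set Implicit Arguments.
Unset Strict Implicit.
Unset Printing Implicit Defensive.
Import Order.TTheory GRing.Theory Num.Theory.
Local Open Scope classical_set_scope.
Local Open Scope ring_scope.

(** Write [e0] for the first coordinate and [F] for the Fine interior of [P].
    Since [-1 <= e0 <= 1] on [P], the conditions of [F] for [e0] and [- e0]
    force [e0 = 0] on [F], so the point is to see that [F] is a polytope whose
    vertices [y] satisfy [u y *+ 2 \in Z] for every dual lattice vector [u].

    Polytope.  [F] is cut out by infinitely many half-spaces, but finitely many
    suffice: if [y] satisfies the conditions for all short dual vectors and
    violates the one of a long vector [n], then a simultaneous Diophantine
    approximation of the direction of [n] is a short dual vector whose
    condition [y] violates too ([fine_interior_polyhedron]).  A bounded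
    polyhedron given by finitely many inequalities is the convex hull of its
    finitely many basic points, those at which the tight functionals have no
    common kernel ([basic_generate], [polyhedron_polytope]), and its vertices
    are basic ([vertex_basic]).

    Half-integrality.  At a basic point [y] of [F] there are two tight dual
    vectors [n1], [n2] which together with [e0] form a basis of the dual space
    ([dual_basis3]).  Let [u = t *: e0 + a *: n1 + b *: n2] be a dual lattice
    vector with [a, b >= 0] and put [x := u y].  On [P] one has
    [n1 >= n1 y - 1] and [n2 >= n2 y - 1]; changing [u] by a multiple of [e0]
    one may take [|t| <= 1/2], and then [u >= x - (a + b) - 1/2] on [P] because
    [|e0| <= 1] there.  The minimum of [u] on the lattice polytope [P] is an
    integer, at most [floor x - 1] as [y] lies in [F].  Hence, for [x] not an
    integer, [a + b >= frac x + 1/2] ([rounding_bound]).  Reduce [a] and [b]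
    modulo 1 and apply this to [u] and to [n1 + n2 - u]: the two inequalities
    add up to an equality, so that [a + b - x - 1/2] is an integer for every
    [u] with [u y] not an integer ([coefficient_parity]).  If [2 x] were not an
    integer, this would hold for [u] and for [2 u], and 1/2 would be an
    integer ([half_integral_value]). *)

(** * Evaluating functionals *)

Section Evaluation.
Variables (R : realType) (E : vectType R).
Implicit Types (n : 'Hom(E, R^o)) (x y : E) (a : R).

(** A functional takes its values in the module [R^o]; these lemmas restate
    linearity with the operations of the ordered field [R]. *)
Lemma homD n x y : (n (x + y) : R) = (n x : R) + n y.
Proof. by rewrite linearD. Qed.

Lemma homB n x y : (n (x - y) : R) = (n x : R) - n y.
Proof. by rewrite linearB. Qed.

Lemma homZ n a x : (n (a *: x) : R) = a * (n x : R).
Proof. by rewrite linearZ. Qed.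

Lemma hom_sum n (I : finType) (F : I -> E) :
  (n (\sum_i F i) : R) = \sum_i (n (F i) : R).
Proof. by rewrite linear_sum. Qed.

Lemma homN n x : ((- n) x : R) = - (n x : R).
Proof. by rewrite opp_lfunE. Qed.

End Evaluation.

(** * Polytopes and their vertices *)

Section Polytope.
Variables (R : realType) (E : vectType R).
Implicit Types (Q : set E) (n : 'Hom(E, R^o)) (x y : E).

Lemma weight_le1 (I : finType) (a : I -> R) i :
  (forall j, 0 <= a j) -> \sum_j a j = 1 -> a i <= 1.
Proof. by move=> a0 <-; rewrite (bigD1 i) //= lerDl sumr_ge0. Qed.

Lemma sum_neq (W : zmodType) (I : finType) (F : I -> W) i :
  \sum_(j | j != i) F j = \sum_j F j - F i.
Proof. by rewrite [in RHS](bigD1 i) //= addrAC subrr add0r. Qed.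

Lemma weight1_eq (I : finType) (p : I -> E) (a : I -> R) i :
  (forall j, 0 <= a j) -> \sum_j a j = 1 -> a i = 1 ->
  \sum_j a j *: p j = p i.
Proof.
move=> a0 a1 ai; have /eqP : \sum_(j | j != i) a j = 0.
  by rewrite sum_neq a1 ai subrr.
rewrite psumr_eq0 // => /allP z.
rewrite (bigD1 i) //= ai scale1r big1 ?addr0 // => j ji.
by have := z j (mem_index_enum _); rewrite ji /= => /eqP->; rewrite scale0r.
Qed.

Lemma hom_convex_ge n (I : finType) (p : I -> E) (a : I -> R) (r : R) :
  (forall i, 0 <= a i) -> \sum_i a i = 1 ->
  (forall i, a i != 0 -> r <= n (p i)) -> r <= n (\sum_i a i *: p i).
Proof.
move=> a0 a1 rp; rewrite hom_sum -[r]mul1r -a1 mulr_suml ler_sum // => i _.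
rewrite homZ; have [->|ai] := eqVneq (a i) 0; first by rewrite !mul0r.
by rewrite ler_wpM2l // rp.
Qed.

Lemma conv_hull_point k (p : 'I_k -> E) i : conv_hull p (p i).
Proof.
exists (fun j => (j == i)%:R); split=> [j|//|]; first by rewrite ler0n.
  by rewrite (bigD1 i) //= eqxx big1 ?addr0 // => j /negPf->.
by rewrite (bigD1 i) //= eqxx scale1r big1 ?addr0 // => j /negPf->; rewrite scale0r.
Qed.

Lemma conv_hull_convex k (p : 'I_k -> E) y z (t : R) :
  0 <= t <= 1 -> conv_hull p y -> conv_hull p z ->
  conv_hull p (t *: y + (1 - t) *: z).
Proof.
move=> /andP[t0 t1] [a [a0 a1 ->]] [b [b0 b1 ->]].
exists (fun i => t * a i + (1 - t) * b i); split=> [i||].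
- by rewrite addr_ge0 // mulr_ge0 // subr_ge0.
- by rewrite big_split /= -!mulr_sumr a1 b1; lra.
- rewrite !scaler_sumr -big_split /=; apply: eq_bigr => i _.
  by rewrite [RHS]scalerDl !scalerA.
Qed.

(** A set [A] of generators of minimal cardinality with the same hull consists
    of vertices: if [p i] lay strictly between two points of the hull other than
    itself, it would be a combination of the other generators, and could be
    removed from [A]. *)
Lemma vertex_generators k (p : 'I_k.+1 -> E) :
  exists A : {set 'I_k.+1}, (forall i, i \in A -> vertex (conv_hull p) (p i)) /\
   forall x, conv_hull p x -> exists a : 'I_k.+1 -> R,
     [/\ forall i, 0 <= a i, \sum_i a i = 1, forall i, a i != 0 -> i \in A
       & x = \sum_i a i *: p i].
Proof.
pose spans (A : {set 'I_k.+1}) := forall x, conv_hull p x ->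
  exists a : 'I_k.+1 -> R, [/\ forall i, 0 <= a i, \sum_i a i = 1,
    forall i, a i != 0 -> i \in A & x = \sum_i a i *: p i].
have [A [spanA minA]] : exists A, spans A /\ forall B, spans B -> (#|A| <= #|B|)%N.
  have ex : exists m, `[< exists A : {set 'I_k.+1}, #|A| = m /\ spans A >].
    exists #|[set: 'I_k.+1]%SET|; apply/asboolP; exists [set: 'I_k.+1]%SET; split=> //.
    by move=> x [a [a0 a1 ->]]; exists a; split=> // i _; rewrite inE.
  case: (ex_minnP ex) => m /asboolP [A [<- sA]] mA; exists A; split=> // B sB.
  by apply: mA; apply/asboolP; exists B.
exists A; split=> // i iA; split; first exact: conv_hull_point.
move=> y z t Qy Qz t0 t1 pE.
have [a [a0 a1 aA yE]] := spanA _ Qy; have [b [b0 b1 bA zE]] := spanA _ Qz.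
(* The point p i is itself the combination of the generators with weights c. *)
pose c j := t * a j + (1 - t) * b j.
have c0 j : 0 <= c j by rewrite addr_ge0 // mulr_ge0 // ?subr_ge0 ltW.
have c1 : \sum_j c j = 1 by rewrite big_split /= -!mulr_sumr a1 b1; lra.
have pc : p i = \sum_j c j *: p j.
  rewrite {1}pE yE zE !scaler_sumr -big_split /=; apply: eq_bigr => j _.
  by rewrite [RHS]scalerDl !scalerA.
have [ci1|ci1] := eqVneq (c i) 1.
  have ai := weight_le1 i a0 a1; have bi := weight_le1 i b0 b1.
  have : t * (1 - a i) + (1 - t) * (1 - b i) = 0.
    by move: ci1; rewrite /c; lra.
  move/eqP; rewrite paddr_eq0 ?mulr_ge0 ?subr_ge0 ?(ltW t0) ?(ltW t1) //.
  rewrite !mulf_eq0 (gt_eqF t0) !subr_eq0 (gt_eqF t1) /= => /andP[/eqP ai1 /eqP bi1].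
  by split; [rewrite yE | rewrite zE]; apply: weight1_eq.
have ci : 0 < 1 - c i by rewrite subr_gt0 lt_neqAle ci1 weight_le1.
have cN : \sum_(j | j != i) c j = 1 - c i.
  by rewrite sum_neq c1.
have cpN : \sum_(j | j != i) c j *: p j = (1 - c i) *: p i.
  by rewrite sum_neq -pc scalerBl scale1r.
(* As c i < 1, the equation p i = \sum_j c j *: p j can be solved for p i. *)
suff /minA : spans (A :\ i)%SET by rewrite (cardsD1 i A) iA ltnn.
move=> x /spanA [d [d0 d1 dA ->]].
exists (fun j => if j == i then 0 else d j + d i / (1 - c i) * c j); split=> [j||j|].
- by case: ifP => // _; rewrite addr_ge0 // mulr_ge0 // divr_ge0 // ltW.
- rewrite (bigD1 i) //= eqxx add0r.
  rewrite (eq_bigr (fun j => d j + d i / (1 - c i) * c j)); last by move=> j /negPf->.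
  by rewrite big_split /= -mulr_sumr cN divfK ?gt_eqF // sum_neq d1 subrK.
- rewrite in_setD1; have [->|/negPf ji /=] := eqVneq j i; first by rewrite eqxx.
  apply: contraR => jA; have dj0 : d j = 0 by apply: contraNeq jA; exact: dA.
  have aj0 : a j = 0 by apply: contraNeq jA; exact: aA.
  have bj0 : b j = 0 by apply: contraNeq jA; exact: bA.
  by rewrite dj0 /c aj0 bj0 !(mulr0, addr0).
- rewrite [RHS](bigD1 i) //= eqxx scale0r add0r.
  rewrite [RHS](eq_bigr (fun j => d j *: p j + (d i / (1 - c i)) *: (c j *: p j))).
    by rewrite big_split /= -scaler_sumr cpN scalerA divfK ?gt_eqF // sum_neq subrK.
  by move=> j /negPf->; rewrite scalerDl scalerA.
Qed.

Lemma polytope_min_vertex Q n : polytope Q ->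
  exists x, vertex Q x /\ forall y, Q y -> (n x : R) <= n y.
Proof.
move=> [k [p ->]]; have [A [vA sA]] := vertex_generators p.
have [i iA] : exists i, i \in A.
  have [a [_ a1 aA _]] := sA _ (conv_hull_point p ord0).
  have [i /aA|a0] := pickP (fun i => a i != 0); first by exists i.
  move: a1; rewrite big1 => [/esym/eqP|i _]; first by rewrite oner_eq0.
  by apply/eqP; rewrite -[_ == _]negbK a0.
have [j jA jmin] := @Order.TotalTheory.arg_minP _ R _ i (mem A) (fun i => n (p i) : R) iA.
exists (p j); split=> [|y /sA [a [a0 a1 aA ->]]]; first exact: vA.
by apply: hom_convex_ge => // l /aA; exact: jmin.
Qed.

Lemma Min_vertex Q n : polytope Q -> exists2 x, vertex Q x & Min Q n = n x.
Proof.
move=> /(polytope_min_vertex n) [x [vx xmin]]; exists x => //.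
apply/eqP; rewrite eq_le; apply/andP; split.
  by apply: ge_inf; [exists (n x) => _ [y Qy <-]; exact: xmin | exists x => //; case: vx].
apply: lb_le_inf; first by exists (n x), x => //; case: vx.
by move=> _ [y Qy <-]; exact: xmin.
Qed.

Lemma Min_le Q n x : polytope Q -> Q x -> Min Q n <= n x.
Proof.
move=> /(polytope_min_vertex n) [y [vy ymin]] Qx.
by apply: ge_inf; [exists (n y) => _ [z Qz <-]; exact: ymin | exists x].
Qed.

Lemma lt_Min Q n (r : R) : polytope Q -> (forall x, Q x -> r < n x) -> r < Min Q n.
Proof. by move=> /(Min_vertex n) [x [Qx _] ->]; apply. Qed.

Lemma le_Min Q n (r : R) : polytope Q -> (forall x, Q x -> r <= n x) -> r <= Min Q n.
Proof. by move=> /(Min_vertex n) [x [Qx _] ->]; apply. Qed.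

Lemma Min_int (L Q : set E) n : polytope Q -> (forall x, vertex Q x -> L x) ->
  dual_lattice L n -> Min Q n \is a Num.int.
Proof. by move=> /(Min_vertex n) [x vx ->] vL; apply; apply: vL. Qed.

End Polytope.
(** * Bounded polyhedra *)

Section Polyhedron.
Variables (R : realType) (E : vectType R).
Variables (I : finType) (n : I -> 'Hom(E, R^o)) (c : I -> R).
Implicit Types (x y w : E).

Definition polyhedron : set E := [set x | forall i, c i <= n i x].

(** A point determined, among all points of the space, by the inequalities that
    are equalities there. *)
Definition basic x := polyhedron x /\
  forall w, (forall i, (n i x : R) = c i -> (n i w : R) = 0) -> w = 0.

Definition slack x : {set I} := [set i | (n i x : R) != c i]%SET.

(** For a nonempty polyhedron this is boundedness. *)
Definition no_recession := forall w, (forall i, 0 <= (n i w : R)) -> w = 0.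

Lemma polyhedron_convex y z (t : R) : 0 <= t <= 1 ->
  polyhedron y -> polyhedron z -> polyhedron (t *: y + (1 - t) *: z).
Proof.
move=> /andP[t0 t1] Py Pz i; rewrite homD !homZ.
have t1' : 0 <= 1 - t by rewrite subr_ge0.
by have := ler_wpM2l t0 (Py i); have := ler_wpM2l t1' (Pz i); lra.
Qed.

(** Walking in a direction that keeps the tight inequalities tight, one leaves
    the polyhedron because there is no recession direction; the exit point
    satisfies one more inequality with equality. *)
Lemma polyhedron_ray x w : no_recession -> polyhedron x -> w != 0 ->
  (forall i, (n i x : R) = c i -> (n i w : R) = 0) ->
  exists l : R, [/\ 0 < l, polyhedron (x + l *: w) &
    (#|slack (x + l *: w)| < #|slack x|)%N].
Proof.
move=> bnd Px w0 tw.
have [j jw] : exists i, (n i w : R) < 0.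
  apply: contrapT => /forallNP nw; move/eqP: w0; apply; apply: bnd => i.
  by rewrite leNgt; apply/negP; exact: nw.
(* The inequality i becomes an equality after time f i. *)
pose f i : R := ((n i x : R) - c i) / - (n i w : R).
have [k kw kmin] := @Order.TotalTheory.arg_minP _ R _ j [pred i | (n i w : R) < 0] f jw.
rewrite /= in kw.
have nk : c k < n k x.
  rewrite lt_neqAle Px andbT eq_sym; apply/eqP => /tw wk.
  by move: kw; rewrite wk ltxx.
have fk : (n k (x + f k *: w) : R) = c k.
  by rewrite homD homZ /f invrN mulrN mulNr divfK ?lt_eqF // opprB addrC subrK.
exists (f k); split.
- by rewrite divr_gt0 // ?subr_gt0 // oppr_gt0.
- move=> i; rewrite homD homZ.
  have [iw|iw] := ltP (n i w : R) 0.
    by have := kmin i iw; rewrite /f ler_pdivlMr ?oppr_gt0 // -/(f k); lra.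
  have := Px i; have : 0 <= f k * (n i w : R); last lra.
  by rewrite mulr_ge0 // divr_ge0 // ?subr_ge0 ?(ltW nk) // oppr_ge0 ltW.
- apply: proper_card; apply/properP; split.
    apply/fintype.subsetP => i; rewrite !inE; apply: contra => /eqP ti.
    by rewrite homD homZ tw // mulr0 addr0 ti.
  by exists k; rewrite !inE ?fk ?eqxx // gt_eqF.
Qed.

(** By induction on the number of slack inequalities: a point that is not basic
    lies between the exit points of the rays [w] and [- w], for a direction [w]
    killed by all its tight functionals. *)
Lemma basic_generate (C : set E) : no_recession ->
  (forall y z (t : R), 0 < t < 1 -> C y -> C z -> C (t *: y + (1 - t) *: z)) ->
  basic `<=` C -> polyhedron `<=` C.
Proof.
move=> bnd Cconv basicC x.
have [m] := ubnP #|slack x|.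
elim: m x => // m IH x xm Px.
have [/basicC //|/not_andP[//|/existsNP[w /not_implyP[tw /eqP w0]]]] := pselect (basic x).
have [l [l0 Pl lm]] := polyhedron_ray bnd Px w0 tw.
have tw' i : (n i x : R) = c i -> (n i (- w) : R) = 0.
  by move=> /tw; rewrite linearN /= => wi; rewrite [n i w]wi oppr0.
have [|k [k0 Pk km]] := polyhedron_ray bnd Px _ tw'; first by rewrite oppr_eq0.
have Cl := IH _ (leq_trans lm xm) Pl; have Ck := IH _ (leq_trans km xm) Pk.
have lk : 0 < l + k by rewrite addr_gt0.
have := Cconv _ _ (k / (l + k)) _ Cl Ck.
rewrite divr_gt0 // ltr_pdivrMr // mul1r ltrDr l0 => /(_ isT).
have -> : 1 - k / (l + k) = l / (l + k).
  by rewrite -[X in X - _](@divff _ (l + k)) ?gt_eqF // -mulrBl addrK.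
have kl : l / (l + k) * k = k / (l + k) * l by rewrite mulrAC [RHS]mulrAC [l * k]mulrC.
congr C; rewrite !scalerDr !scalerA addrACA -scalerDl -mulrDl [k + l]addrC.
by rewrite divff ?gt_eqF // scale1r scalerN kl subrr addr0.
Qed.

(** Removing a vertex leaves a convex set; if the vertex were not basic, this
    set would still contain all basic points. *)
Lemma vertex_basic x : no_recession -> vertex polyhedron x -> basic x.
Proof.
move=> bnd [Px xv]; apply: contrapT => nbx.
suff /(_ x Px) [_] : polyhedron `<=` polyhedron `&` [set y | y <> x] by [].
apply: basic_generate => // [y z t /andP[t0 t1] [Py yx] [Pz zx]|y by_].
  split; first by apply: polyhedron_convex => //; rewrite !ltW.
  by move=> /= e; case: (xv y z t Py Pz t0 t1 (esym e)).
by split; [case: by_ | move=> /= yx; apply: nbx; rewrite -yx].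
Qed.

Lemma basic_inj x y : basic x -> basic y ->
  (forall i, ((n i x : R) == c i) = ((n i y : R) == c i)) -> x = y.
Proof.
move=> [_ bx] _ xy; apply/eqP; rewrite -subr_eq0; apply/eqP; apply: bx => i xi.
by rewrite homB xi; apply/eqP; rewrite subr_eq0 eq_sym -xy xi.
Qed.

(** A basic point is determined by its set of tight inequalities, so that the
    subsets of [I] enumerate the basic points. *)
Lemma polyhedron_polytope : no_recession -> polyhedron !=set0 -> polytope polyhedron.
Proof.
move=> bnd [x0 Px0].
pose tight x := [set i | (n i x : R) == c i]%SET.
(* Subsets that are not the tight set of a basic point are sent to the
   default point x0 of the polyhedron, which does not enlarge the hull. *)
pose q (A : {set I}) := xget x0 [set x | basic x /\ tight x = A].
have Pq A : polyhedron (q A).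
  by rewrite /q; case: xgetP => // y _ [[]].
have qtight x : basic x -> q (tight x) = x.
  move=> bx; rewrite /q; case: xgetP => [y _ [by_ yx]|/(_ x)]; last by case.
  by apply: basic_inj => // i; have /setP/(_ i) := yx; rewrite !inE.
pose s := enum {: {set I}}.
exists (size s), (fun i : 'I_(size s).+1 => q (nth finset.set0 s i)).
apply/seteqP; split; last first.
  by move=> _ [a [a0 a1 ->]] i; apply: hom_convex_ge => // j _; exact: Pq.
apply: basic_generate => // [y z t /andP[t0 t1]|x bx].
  by apply: conv_hull_convex; rewrite !ltW.
have xs : (index (tight x) s < (size s).+1)%N by rewrite ltnS index_size.
rewrite -[x]qtight // -[tight x](@nth_index _ finset.set0 _ s) ?mem_enum //.
exact: (conv_hull_point (fun i : 'I_(size s).+1 => q (nth finset.set0 s i)) (Ordinal xs)).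
Qed.

End Polyhedron.
(** * Simultaneous Diophantine approximation *)

Section Dirichlet.
Variable R : realType.

(** Dirichlet's theorem, by the pigeonhole principle: among the fractional parts
    of the vectors [q r] for [0 <= q <= K.+1 ^ d], two lie in the same cube of
    side [1 / K.+1]. *)
Lemma simultaneous_approximation (d K : nat) (r : 'I_d -> R) :
  exists (q : nat) (z : 'I_d -> int), (0 < q <= K.+1 ^ d)%N /\
    forall j, `|q%:R * r j - (z j)%:~R| <= K.+1%:R^-1.
Proof.
pose fr (q : nat) j : R := q%:R * r j - (Num.floor (q%:R * r j))%:~R.
have K0 : (0 : R) < K.+1%:R by rewrite ltr0n.
have frge0 q j : 0 <= K.+1%:R * fr q j.
  by rewrite mulr_ge0 ?(ltW K0) // subr_ge0 floor_le.
have frlt q j : (Num.truncn (K.+1%:R * fr q j) < K.+1)%N.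
  rewrite truncn_lt_nat // -[X in _ < X]mulr1 ltr_pM2l // /fr ltrBlDl.
  by have := floorD1_gt (q%:R * r j); rewrite intrD.
pose box (q : 'I_(K.+1 ^ d).+1) : {ffun 'I_d -> 'I_K.+1} :=
  [ffun j => Ordinal (frlt q j)].
have /injectivePn [x [y xy bxy]] : ~~ injectiveb box.
  apply/negP => /injectiveP /leq_card.
  by rewrite card_ffun !card_ord ltnn.
wlog yx : x y xy bxy / (y < x)%N => [main|].
  case: (ltngtP x y) => [|?|/val_inj e]; [|exact: (main x y)|].
    by apply: (main y x); rewrite // eq_sym.
  by rewrite e eqxx in xy.
exists (x - y)%N, (fun j => Num.floor (x%:R * r j) - Num.floor (y%:R * r j)); split.
  by rewrite subn_gt0 yx /= (leq_trans (leq_subr _ _)) // -ltnS.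
move=> j; have := congr1 (fun f : {ffun 'I_d -> 'I_K.+1} => val (f j)) bxy.
rewrite !ffunE /= => e.
have /andP[x1 x2] := truncn_itv (frge0 x j); have /andP[y1 y2] := truncn_itv (frge0 y j).
rewrite e in x1 x2; set m := Num.truncn _ in x1 x2 y1 y2.
rewrite -(addn1 m) natrD in x2 y2.
have -> : (x - y)%:R * r j - (Num.floor (x%:R * r j) - Num.floor (y%:R * r j))%:~R
  = fr x j - fr y j.
  by rewrite /fr natrB ?(ltnW yx) // intrB; ring.
rewrite -div1r ler_pdivlMr // mulrC -[K.+1%:R]ger0_norm ?(ltW K0) // -normrM mulrBr.
by rewrite ler_norml; apply/andP; split; lra.
Qed.

End Dirichlet.

(** * Lattices and dual lattices *)

Section LatticeCoordinates.
Variables (R : realType) (E : vectType R).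
Implicit Types (L P : set E) (n : 'Hom(E, R^o)) (x y : E).

Lemma lattice_coordinates d L : is_lattice d L ->
  exists (l : 'I_d -> E) (e : 'I_d -> 'Hom(E, R^o)),
    [/\ forall x, x = \sum_j (e j x : R) *: l j,
        forall i j, (e i (l j) : R) = (i == j)%:R &
        forall x, L x <-> forall j, (e j x : R) \is a Num.int].
Proof.
move=> [b bb ->]; have bf := basis_free bb.
pose e j : 'Hom(E, R^o) := linfun (coord b j : E -> R^o).
have eE j x : (e j x : R) = coord b j x by rewrite lfunE.
exists (fun j => b`_j), e; split=> [x|i j|x].
- by rewrite {1}(coord_basis bb (memvf x)); apply: eq_bigr => j _; rewrite eE.
- by rewrite eE coord_free // eq_sym.
- split=> [[a ->] j|xint].
    rewrite eE (eq_bigr (fun i => (a i)%:~R *: b`_i)) => [|i _].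
      by rewrite coord_sum_free // intr_int.
    by rewrite scaler_int.
  exists [ffun j => Num.floor (e j x : R)].
  rewrite {1}(coord_basis bb (memvf x)); apply: eq_bigr => j _.
  by rewrite ffunE -scaler_int -eE floorK.
Qed.

End LatticeCoordinates.
Section DualLattice.
Variables (R : realType) (E : vectType R).
Implicit Types (L P : set E) (n m : 'Hom(E, R^o)) (x y : E).

Lemma hom_addE n m x : ((n + m) x : R) = (n x : R) + m x.
Proof. by rewrite add_lfunE. Qed.

Lemma hom_scaleE (a : R) n x : ((a *: n) x : R) = a * (n x : R).
Proof. by rewrite scale_lfunE. Qed.

Lemma hom_sumE (I : finType) (F : I -> 'Hom(E, R^o)) x :
  ((\sum_i F i) x : R) = \sum_i (F i x : R).
Proof. by rewrite sum_lfunE. Qed.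

Lemma dual_latticeD L n m : dual_lattice L n -> dual_lattice L m -> dual_lattice L (n + m).
Proof. by move=> Ln Lm x Lx; rewrite hom_addE rpredD ?Ln ?Lm. Qed.

Lemma dual_latticeZ L n (z : int) : dual_lattice L n -> dual_lattice L (z%:~R *: n).
Proof. by move=> Ln x Lx; rewrite hom_scaleE rpredM ?intr_int ?Ln. Qed.

Lemma dual_latticeN L n : dual_lattice L n -> dual_lattice L (- n).
Proof. by move=> Ln x Lx; rewrite homN rpredN Ln. Qed.

End DualLattice.

(** * The Fine interior is a polyhedron *)

Section FineInterior.
Variables (R : realType) (E : vectType R).
Implicit Types (L P : set E) (n m : 'Hom(E, R^o)) (x y : E).

(** The dual vectors with coordinates bounded by a suitable [B] suffice.  Let
    [y] satisfy their conditions and violate the one of [n0], i.e.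
    [n0 (p - y) > -1] on [P].  If [mu] is the size of [n0], Dirichlet's theorem
    gives [q <= Q] and a dual vector [h z] whose coordinates differ by at most
    [1 / K.+1] from those of [q / mu *: n0].  For [mu > B = 2 Q] and [K] large,
    [h z (p - y) > - 1/2 - 1/2] on [P], while [h z] is short enough for its
    condition to hold at [y].  That [K] can be chosen independently of [y] comes
    from the conditions of the coordinate functionals, which bound [p - y]. *)
Lemma fine_interior_polyhedron d L P : is_lattice d L -> polytope P ->
  exists (I : finType) (n : I -> 'Hom(E, R^o)),
    [/\ forall i, dual_lattice L (n i) /\ n i != 0, no_recession n &
        fine_interior L P = polyhedron n (fun i => Min P (n i) + 1)].
Proof.
move=> /lattice_coordinates [l [e [xE el Lint]]] Ppoly.
(* A bound for the j-th coordinate of p - y. *)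
pose w j : R := - Min P (- e j) - Min P (e j) - 1.
pose K := (Num.bound (2 * `|\sum_j w j|)).+1.
pose Q := (K.+1 ^ d)%N; pose B := (2 * Q)%N.
have Q0 : (0 < Q)%N by rewrite expn_gt0.
have B0 : (0 < B)%N by rewrite muln_gt0.
pose h (z : 'I_d -> int) : 'Hom(E, R^o) := \sum_j (z j)%:~R *: e j.
have hE z x : (h z x : R) = \sum_j (z j)%:~R * (e j x : R).
  by rewrite hom_sumE; apply: eq_bigr => j _; rewrite hom_scaleE.
have hl z i : (h z (l i) : R) = (z i)%:~R.
  rewrite hE (bigD1 i) //= el eqxx mulr1 big1 ?addr0 // => j /negPf ji.
  by rewrite el ji mulr0.
have hdual z : dual_lattice L (h z).
  move=> x /Lint xint; rewrite hE rpred_sum // => j _.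
  by rewrite rpredM ?intr_int.
have e_nz j : e j != 0.
  apply/eqP => ej0; have := el j j.
  by rewrite eqxx ej0 lfunE /= => /esym/eqP; rewrite oner_eq0.
have eh j : e j = h (fun i => (i == j)%:Z).
  rewrite /h (bigD1 j) //= eqxx scale1r big1 ?addr0 // => i /negPf->.
  by rewrite scale0r.
have Neh j : - e j = h (fun i => - (i == j)%:Z).
  rewrite {1}eh /h -sumrN; apply: eq_bigr => i _.
  by rewrite -scaleNr -mulrNz.
(* The ordinals below 2 * B + 1, shifted by B, enumerate the coordinates from
   - B to B. *)
pose T := {ffun 'I_d -> 'I_(2 * B).+1}.
pose zz (t : T) (j : 'I_d) : int := (t j)%:Z - B%:Z.
pose n (i : {t : T | h (zz t) != 0}) := h (zz (val i)).
have cover z : (forall j, (`|z j| <= B)%N) -> h z != 0 -> exists i, n i = h z.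
  move=> zB hz; pose t : T := [ffun j => inord (absz (z j + B%:Z)%R)].
  have tz : h (zz t) = h z.
    apply: eq_bigr => j _; congr (_%:~R *: _); rewrite /zz ffunE inordK; have := zB j; lia.
  have ht : h (zz t) != 0 by rewrite tz.
  by exists (Sub t ht); rewrite /n SubK.
have cover_e j : exists i, n i = e j.
  by rewrite eh; apply: cover; [move=> i; case: eqP => _; lia | rewrite -eh].
have cover_Ne j : exists i, n i = - e j.
  by rewrite Neh; apply: cover; [move=> i; case: eqP => _; lia | rewrite -Neh oppr_eq0].
exists {t : T | h (zz t) != 0}, n; split=> [i|v nv|].
- by split; [exact: hdual | exact: (valP i)].
- rewrite [v]xE big1 // => j _; have [i iE] := cover_e j; have [i' iE'] := cover_Ne j.
  have := nv i; have := nv i'; rewrite iE iE' homN => ? ?.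
  by rewrite (_ : (e j v : R) = 0) ?scale0r //; lra.
apply/seteqP; split=> [y Fy i|y Py n0 n0L n0_nz].
  by apply: Fy; [exact: hdual | exact: (valP i)].
have cons z : (forall j, (`|z j| <= B)%N) -> h z != 0 -> Min P (h z) + 1 <= h z y.
  by move=> zB hz; have [i <-] := cover z zB hz; exact: Py.
pose a j := Num.floor (n0 (l j) : R).
have aE : n0 = h a.
  apply/lfunP => x; rewrite [x]xE !linear_sum; apply: eq_bigr => j _.
  rewrite !linearZ; congr (_ *: _); rewrite [RHS]hl /a floorK //.
  by apply: n0L; apply/Lint => i; rewrite el; case: eqP.
have [j1 aj1] : exists j, a j != 0.
  apply: contrapT => /forallNP a0; move/eqP: n0_nz; apply; rewrite aE /h big1 // => j _.
  by have /negP := a0 j; rewrite negbK => /eqP->; rewrite scale0r.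
have [j0 _ amax] := @arg_maxnP _ j1 xpredT (fun j => `|a j|%N) isT.
set mu := `|a j0|%N in amax.
have mu0 : (0 < mu)%N by apply: leq_trans (amax j1 isT); rewrite absz_gt0.
have [muB|Bmu] := leqP mu B.
  by rewrite aE; apply: cons; [move=> j; apply: leq_trans muB; exact: amax|rewrite -aE].
rewrite leNgt; apply/negP => lt_y.
have n0P p : P p -> -1 < n0 p - n0 y :> R.
  by move=> Pp; have := Min_le n0 Ppoly Pp; lra.
have mu0R : (0 : R) < mu%:R by rewrite ltr0n.
have [q [z [/andP[q0 qQ] zq]]] := simultaneous_approximation K (fun j => (a j)%:~R / mu%:R : R).
have K2 : K.+1%:R^-1 <= 2^-1 :> R.
  by rewrite lef_pV2 ?posrE ?ltr0n // ler_nat.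
have r1 j : `|(a j)%:~R / mu%:R : R| <= 1.
  rewrite normrM normfV [`|mu%:R|]ger0_norm ?ler0n // ler_pdivrMr // mul1r.
  by rewrite -intr_norm -[mu%:R]/(mu%:Z%:~R) ler_int; have := amax j isT; lia.
have zB j : (`|z j| <= B)%N.
  suff : `|z j|%:~R < (q.+1%:R : R) by rewrite -[q.+1%:R]/(q.+1%:Z%:~R) ltr_int /B; lia.
  have := le_trans (zq j) K2; have := r1 j; rewrite intr_norm -(addn1 q) natrD => rj.
  have : `|q%:R * ((a j)%:~R / mu%:R)| <= q%:R :> R.
    by rewrite normrM [`|q%:R|]ger0_norm ?ler0n // ler_piMr ?ler0n.
  have := ler_distD (q%:R * ((a j)%:~R / mu%:R)) (z j)%:~R (0 : R).
  rewrite !subr0 distrC; lra.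
(* The largest coordinate of q / mu *: n0 has absolute value q >= 1, so the
   corresponding coordinate of z, at distance at most 1/2, does not vanish. *)
have hz : h z != 0.
  apply/eqP => hz0; have zj0 : (z j0)%:~R = 0 :> R by rewrite -hl hz0 lfunE.
  have := le_trans (zq j0) K2; rewrite zj0 subr0 normrM [`|q%:R|]ger0_norm ?ler0n //.
  rewrite normrM -intr_norm normfV [`|mu%:R|]ger0_norm ?ler0n //.
  rewrite -[mu%:R]/(mu%:Z%:~R) abszE divff ?intr_eq0 ?mulr1; last by lia.
  have : 1 <= q%:R :> R by rewrite ler1n.
  lra.
suff : h z y < Min P (h z) + 1 by rewrite ltNge (cons z zB hz).
rewrite -ltrBlDr; apply: lt_Min => // p Pp.
have ew j : `|(e j p : R) - e j y| <= w j.
  have := Min_le (e j) Ppoly Pp; have := Min_le (- e j) Ppoly Pp; rewrite homN.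
  have [i iE] := cover_e j; have := Py i; rewrite iE.
  have [i' iE'] := cover_Ne j; have := Py i'; rewrite iE' homN.
  by rewrite ler_norml /w => ? ? ? ?; apply/andP; split; lra.
have err : \sum_j (q%:R * ((a j)%:~R / mu%:R) - (z j)%:~R) * ((e j p : R) - e j y) <= 2^-1.
  apply: (@le_trans _ _ (\sum_j K.+1%:R^-1 * w j)).
    apply: ler_sum => j _; apply: le_trans (ler_norm _) _.
    by rewrite normrM ler_pM.
  rewrite -mulr_sumr mulrC ler_pdivrMr ?ltr0n //.
  have := @archi_boundP _ (2 * `|\sum_j w j|); rewrite mulr_ge0 // => /(_ isT).
  have := ler_norm (\sum_j w j); rewrite /K; set b := Num.bound _.
  rewrite -(addn2 b) natrD; lra.
have split_h : (h z p : R) - h z y = q%:R / mu%:R * ((n0 p : R) - n0 y)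
  - \sum_j (q%:R * ((a j)%:~R / mu%:R) - (z j)%:~R) * ((e j p : R) - e j y).
  rewrite aE !hE -!sumrB mulr_sumr -sumrB; apply: eq_bigr => j _; ring.
have qmu : q%:R / mu%:R < 2^-1 :> R.
  rewrite ltr_pdivrMr // mulrC ltr_pdivlMr ?ltr0n // -natrM ltr_nat.
  by apply: leq_ltn_trans Bmu; rewrite /B mulnC leq_mul2l.
have qmu0 : 0 <= q%:R / mu%:R :> R by rewrite divr_ge0 // ler0n.
have := ler_wpM2l qmu0 (ltW (n0P p Pp)); lra.
Qed.

End FineInterior.

(** * Half-integrality at two tight conditions *)

Section HalfIntegrality.
Variables (R : realType) (E : vectType R) (L P : set E) (e0 : 'Hom(E, R^o)) (y : E).
Hypotheses (Ppoly : polytope P) (Pvert : forall x, vertex P x -> L x).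
Hypotheses (e0L : dual_lattice L e0) (Pstrip : forall p, P p -> -1 <= (e0 p : R) <= 1).
Hypotheses (Fy : fine_interior L P y) (e0y : (e0 y : R) = 0).
Variables (n1 n2 : 'Hom(E, R^o)).
Hypotheses (n1L : dual_lattice L n1) (n1y : Min P n1 + 1 = n1 y).
Hypotheses (n2L : dual_lattice L n2) (n2y : Min P n2 + 1 = n2 y).
Implicit Types (u : 'Hom(E, R^o)) (t a b : R).

Let combE t a b x : ((t *: e0 + a *: n1 + b *: n2) x : R) =
  t * (e0 x : R) + a * (n1 x : R) + b * (n2 x : R).
Proof. by rewrite !hom_addE !hom_scaleE. Qed.

(** Let [z] be the integer nearest to [t].  Then [u - z *: e0] has the same value
    at [y] as [u], and is at least [u y - (a + b) - 1/2] on [P]; its minimum on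
    [P] is an integer not exceeding [floor (u y) - 1]. *)
Lemma rounding_bound u t a b : dual_lattice L u -> u = t *: e0 + a *: n1 + b *: n2 ->
  0 <= a -> 0 <= b -> (u y : R) \isn't a Num.int ->
  (u y : R) + 2^-1 <= (Num.floor (u y : R))%:~R + a + b.
Proof.
move=> uL uE a0 b0 uy; pose z := Num.floor (t + 2^-1); pose n := u + (- z)%:~R *: e0.
have nL : dual_lattice L n by apply: dual_latticeD => //; exact: dual_latticeZ.
have ny : (n y : R) = u y by rewrite hom_addE hom_scaleE e0y mulr0 addr0.
have n_nz : n != 0.
  by apply: contraNneq uy => n0; rewrite -ny n0 lfunE /= rpred0.
have Mn : Min P n + 1 <= (Num.floor (u y : R))%:~R.
  have Mint : Min P n + 1 \is a Num.int by rewrite rpredD ?rpred1 // (Min_int Ppoly Pvert nL).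
  by rewrite -(floorK Mint) ler_int le_floor // -ny; apply: Fy.
suff : (u y : R) - (a + b) - 2^-1 <= Min P n by lra.
apply: le_Min => // p Pp; rewrite hom_addE hom_scaleE uE !combE e0y.
have h1 := ler_wpM2l a0 (Min_le n1 Ppoly Pp); have h2 := ler_wpM2l b0 (Min_le n2 Ppoly Pp).
have r : `|(t - z%:~R) * (e0 p : R)| <= 2^-1.
  rewrite -[2^-1]mulr1 normrM ler_pM // ler_norml.
    have := floor_itv (t + 2^-1); rewrite -/z intrD => /andP[? ?].
    by apply/andP; split; lra.
  exact: Pstrip.
move: r; rewrite ler_norml mulrNz => /andP[r _].
rewrite -n1y -n2y; lra.
Qed.

Let n1_int : (n1 y : R) \is a Num.int.
Proof. by rewrite -n1y rpredD ?rpred1 // (Min_int Ppoly Pvert n1L). Qed.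

Let n2_int : (n2 y : R) \is a Num.int.
Proof. by rewrite -n2y rpredD ?rpred1 // (Min_int Ppoly Pvert n2L). Qed.

(** With [u1] obtained from [u] by reducing [a] and [b] modulo 1, the bounds for
    [u1] and for [u2 = n1 + n2 - u1] leave no slack: their sum is an equality,
    because [u1 y + u2 y] is an integer. *)
Lemma coefficient_parity u t a b : dual_lattice L u ->
  u = t *: e0 + a *: n1 + b *: n2 -> (u y : R) \isn't a Num.int ->
  a + b - (u y : R) - 2^-1 \is a Num.int.
Proof.
move=> uL uE uy; pose fa := Num.floor a; pose fb := Num.floor b.
have /andP[fa1 fa2] := floor_itv a; have /andP[fb1 fb2] := floor_itv b.
rewrite -/fa -/fb !intrD in fa1 fa2 fb1 fb2.
pose u1 : 'Hom(E, R^o) := u + (- fa)%:~R *: n1 + (- fb)%:~R *: n2.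
pose u2 : 'Hom(E, R^o) := - u1 + n1 + n2.
have u1L : dual_lattice L u1 
  by apply: dual_latticeD; [apply: dual_latticeD|]; rewrite //; exact: dual_latticeZ.
have u2L : dual_lattice L u2 
  by apply: dual_latticeD => //; apply: dual_latticeD => //; exact: dual_latticeN.
have u1E : u1 = t *: e0 + (a - fa%:~R) *: n1 + (b - fb%:~R) *: n2.
  apply/lfunP => x; apply: (etrans (y := _ : R)); last exact/esym/combE.
  by rewrite !hom_addE !hom_scaleE uE combE !mulrNz; ring.
have u2E : u2 = (- t) *: e0 + (1 - (a - fa%:~R)) *: n1 + (1 - (b - fb%:~R)) *: n2.
  apply/lfunP => x; apply: (etrans (y := _ : R)); last exact/esym/combE.
  by rewrite !hom_addE homN u1E combE; ring.
have u1y : (u1 y : R) = (u y : R) - fa%:~R * (n1 y : R) - fb%:~R * (n2 y : R).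
  by rewrite !hom_addE !hom_scaleE !mulrNz; ring.
have u2y : (u2 y : R) = - (u1 y : R) + (n1 y : R) + (n2 y : R).
  by rewrite /u2 hom_addE hom_addE homN.
have u1I : (u1 y : R) \isn't a Num.int.
  apply: contraNN uy => u1i.
  have -> : (u y : R) = (u1 y : R) + fa%:~R * (n1 y : R) + fb%:~R * (n2 y : R).
    by rewrite u1y; ring.
  by rewrite !rpredD // rpredM ?intr_int.
have u2I : (u2 y : R) \isn't a Num.int.
  apply: contraNN u1I => u2i.
  have -> : (u1 y : R) = (n1 y : R) + (n2 y : R) - (u2 y : R) by rewrite u2y; ring.
  by rewrite rpredB // rpredD.
have k1 := rounding_bound u1L u1E _ _ u1I.
have k2 := rounding_bound u2L u2E _ _ u2I.
have {}k1 := k1 ltac:(lra) ltac:(lra); have {}k2 := k2 ltac:(lra) ltac:(lra).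
have floor_lt (x : R) : x \isn't a Num.int -> (Num.floor x)%:~R < x.
  by move=> xI; rewrite lt_neqAle floor_le andbT -intrEfloor.
have fl : (Num.floor (u1 y : R))%:~R + (Num.floor (u2 y : R))%:~R + 1 <= (u1 y : R) + u2 y.
  have sI : (u1 y : R) + u2 y \is a Num.int.
    have -> : (u1 y : R) + u2 y = (n1 y : R) + n2 y by rewrite u2y; ring.
    by rewrite rpredD.
  have lt1 := floor_lt _ u1I; have lt2 := floor_lt _ u2I.
  have : (Num.floor (u1 y : R) + Num.floor (u2 y : R))%:~R
      < (Num.floor ((u1 y : R) + u2 y))%:~R :> R by rewrite intrD (floorK sI); lra.
  by rewrite ltr_int -lezD1 -(ler_int R) (floorK sI) !intrD.
have eq1 : (u1 y : R) + 2^-1 = (Num.floor (u1 y : R))%:~R + (a - fa%:~R) + (b - fb%:~R).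
  by lra.
have -> : a + b - (u y : R) - 2^-1 = fa%:~R + fb%:~R - (Num.floor (u1 y : R))%:~R
    - fa%:~R * (n1 y : R) - fb%:~R * (n2 y : R) by lra.
by rewrite !(rpredB, rpredD, rpredM) ?intr_int.
Qed.

Lemma half_integral_value u t a b : dual_lattice L u ->
  u = t *: e0 + a *: n1 + b *: n2 -> (u y : R) *+ 2 \is a Num.int.
Proof.
move=> uL uE; apply/negPn/negP => u2I.
have uI : (u y : R) \isn't a Num.int by apply: contraNN u2I => uI; rewrite rpredMn.
have u2L : dual_lattice L (2%:~R *: u) by exact: dual_latticeZ.
have u2E : 2%:~R *: u = (2 * t) *: e0 + (2 * a) *: n1 + (2 * b) *: n2.
  by rewrite uE !scalerDr !scalerA.
have u2y : ((2%:~R *: u) y : R) = (u y : R) *+ 2 by rewrite hom_scaleE mulr_natl.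
have p1 := coefficient_parity uL uE uI.
have := coefficient_parity u2L u2E; rewrite u2y => /(_ u2I) p2.
have : (2^-1 : R) \is a Num.int.
  have -> : (2^-1 : R) = (2 * a + 2 * b - (u y : R) *+ 2 - 2^-1)
      - (a + b - (u y : R) - 2^-1) *+ 2 by rewrite !mulr2n; lra.
  by rewrite rpredB // rpredMn.
move=> /norm_intr_ge1; rewrite invr_neq0 ?pnatr_eq0 // => /(_ isT).
rewrite ger0_norm; lra.
Qed.

End HalfIntegrality.

(** * Bases of a three-dimensional dual space *)

Section DualBasis.
Variables (R : realType) (E : vectType R).

Lemma common_kernel k (f : 'I_k -> 'Hom(E, R^o)) : (k < \dim {:E})%N ->
  exists2 w, w != 0 & forall i, (f i w : R) = 0.
Proof.
move=> kE; pose phi (w : E) : 'rV[R]_k := \row_i (f i w : R).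
have phi_lin : linear phi.
  by move=> a u v; apply/rowP => i; rewrite !mxE homD homZ.
pose phiL : {linear E -> 'rV[R]_k} :=
  HB.pack phi (GRing.isLinear.Build _ _ _ _ phi phi_lin).
pose g := linfun phiL.
have kerg : lker g != 0%VS.
  rewrite -dimv_eq0 -lt0n; have := limg_ker_dim g fullv; rewrite capfv => gd.
  have : (\dim (g @: fullv) <= k)%N.
    by apply: leq_trans (dimvS (subvf _)) _; rewrite dimvf dim_matrix mul1r.
  by move: kE; rewrite -gd; lia.
exists (vpick (lker g)) => [|i]; first by rewrite vpick0.
have := memv_pick (lker g); rewrite memv_ker => /eqP.
by rewrite lfunE /= => /rowP/(_ i); rewrite !mxE.
Qed.

(** The functionals are found one at a time: as long as fewer than three have
    been chosen, they have a common nonzero kernel vector, on which some member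
    of [D] does not vanish. *)
Lemma dual_basis3 (e0 : 'Hom(E, R^o)) (D : 'Hom(E, R^o) -> Prop) :
  \dim {:E} = 3 -> e0 != 0 ->
  (forall w, (forall n, D n -> (n w : R) = 0) -> w = 0) ->
  exists n1 n2, [/\ D n1, D n2 &
    forall u, exists t a b : R, u = t *: e0 + a *: n1 + b *: n2].
Proof.
move=> dim3 e0nz Dker.
have pick w : w != 0 -> exists2 n, D n & (n w : R) != 0.
  move=> w0; apply: contrapT => nD; move/eqP: w0; apply; apply: Dker => n Dn.
  by apply: contrapT => /eqP nw; apply: nD; exists n.
have [w1 w1nz /(_ ord0) /= e0w1] := @common_kernel 1 (fun=> e0) ltac:(by rewrite dim3).
have [n1 Dn1 n1w1] := pick w1 w1nz.
have [w2 w2nz fw2] :=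
  @common_kernel 2 (fun i => if i == ord0 then e0 else n1) ltac:(by rewrite dim3).
have e0w2 : (e0 w2 : R) = 0 by exact: (fw2 ord0).
have n1w2 : (n1 w2 : R) = 0 by exact: (fw2 (lift ord0 ord0)).
have [n2 Dn2 n2w2] := pick w2 w2nz.
exists n1, n2; split=> // u.
pose X := [tuple e0; n1; n2].
have XE (k : 'I_3 -> R) : \sum_i k i *: X`_i = 
    k ord0 *: e0 + k (lift ord0 ord0) *: n1 + k (lift ord0 (lift ord0 ord0)) *: n2.
  by rewrite !big_ord_recl big_ord0 /= addr0 addrA.
have Xfree : free X.
  apply/freeP => k; rewrite XE => k0.
  have kx x : k ord0 * (e0 x : R) + k (lift ord0 ord0) * (n1 x : R)
     + k (lift ord0 (lift ord0 ord0)) * (n2 x : R) = 0.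
    by rewrite -!hom_scaleE -!hom_addE k0 lfunE.
  have := kx w2; rewrite e0w2 n1w2 !mulr0 !add0r => /eqP.
  rewrite mulf_eq0 (negPf n2w2) orbF => /eqP k3.
  have := kx w1; rewrite e0w1 k3 mulr0 mul0r add0r addr0 => /eqP.
  rewrite mulf_eq0 (negPf n1w1) orbF => /eqP k2.
  move: k0; rewrite k2 k3 !scale0r !addr0 => /eqP; rewrite scaler_eq0 (negPf e0nz) orbF => /eqP k1.
  move=> i; case: (unliftP ord0 i) => [j|] ->; last by rewrite k1.
  by case: (unliftP ord0 j) => [j'|] ->; [rewrite (ord1 j') k3 | rewrite k2].
have Xbasis : basis_of fullv X.
  rewrite basisEfree Xfree subvf /= [X in (X <= _)%N](_ : _ = (\dim {:E} * 1)%N).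
    by rewrite dim3.
  by rewrite !dimvf.
have := coord_basis Xbasis (memvf u); rewrite XE => ->.
by do 3!eexists; reflexivity.
Qed.

End DualBasis.

(** * Product of the integers with a lattice, and the conclusion *)

Lemma lattice_prod (R : realType) (V : vectType R) d (M : set V) :
  is_lattice d M -> is_lattice d.+1 ((@Zset R `*` M) : set (R^o * V)%type).
Proof.
move=> [b bb ->].
pose c : d.+1.-tuple (R^o * V)%type := [tuple of ((1 : R^o), (0 : V)) :: map (fun v => ((0 : R^o), v)) b].
have cS (k : 'I_d) : c`_(lift ord0 k) = ((0 : R^o), b`_k).
  by rewrite /= add0n (nth_map 0) // size_tuple.
have sumE (r : R) (f : 'I_d -> R) : r *: c`_(@ord0 d) + \sum_k f k *: c`_(lift ord0 k)
   = ((r : R^o), \sum_k f k *: b`_k).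
  have -> : \sum_k f k *: c`_(lift ord0 k) = ((0 : R^o), \sum_k f k *: b`_k).
    apply: (big_rec2 (fun x v => x = ((0 : R^o), v))) => // k x v _ ->.
    rewrite cS; transitivity ((f k * 0 + 0 : R^o), f k *: b`_k + v) => //.
    by rewrite mulr0 addr0.
  transitivity ((r * 1 + 0 : R^o), r *: (0 : V) + \sum_k f k *: b`_k) => //.
  by rewrite mulr1 addr0 scaler0 add0r.
exists c.
  rewrite basisEdim; apply/andP; split.
    apply/subvP => -[r v] _.
    rewrite (coord_basis bb (memvf v)) -sumE.
    apply: memvD; last apply: memv_suml => k _.
      by rewrite memvZ // memv_span // mem_nth // size_tuple.
    by rewrite memvZ // memv_span // mem_nth // size_tuple.
  rewrite size_tuple dimvf.
  have := size_basis bb; by rewrite dimvf => <-.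
apply/seteqP; split=> [[r v] [/= rI [a vE]]|[r v] [a]].
  exists [ffun i => if unlift ord0 i is Some k then a k else Num.floor (r : R)].
  rewrite big_ord_recl ffunE unlift_none -scaler_int.
  rewrite (eq_bigr (fun k => (a k)%:~R *: c`_(lift ord0 k))); last first.
    by move=> k _; rewrite ffunE liftK scaler_int.
  rewrite sumE floorK // vE; congr (_, _); apply: eq_bigr => k _.
  by rewrite scaler_int.
rewrite big_ord_recl -scaler_int.
rewrite (eq_bigr (fun k => (a (lift ord0 k))%:~R *: c`_(lift ord0 k))); last first.
  by move=> k _; rewrite scaler_int.
rewrite sumE => -[-> ->]; split; first exact: intr_int.
exists [ffun k => a (lift ord0 k)]; apply: eq_bigr => k _.
by rewrite ffunE scaler_int.
Qed.

Theorem theorem3p2 (R : realType) (V : vectType R) (M : set V)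
    (P : set (R^o * V)%type) :
  let L : set (R^o * V)%type := @Zset R `*` M in
  is_lattice 2 M ->
  lattice_polytope L P 3 ->
  lattice_width L P = 2 ->
  P `<=` [set x : R^o | -1 <= x <= 1] `*` [set: V] ->
  has_dim (fine_interior L P) 2 ->
  fine_interior L P `<=` [set (0 : R^o)] `*` [set: V] /\
  half_integral_polygon L (fine_interior L P).
Proof.
move=> L Mlat [Ppoly _ Pvert] _ Pstrip Fdim.
have Llat : is_lattice 3 L by exact: lattice_prod.
pose e0 : 'Hom((R^o * V)%type, R^o) := linfun (fst : (R^o * V)%type -> R^o).
have e0E (x : (R^o * V)%type) : e0 x = x.1 by rewrite lfunE.
have e0L : dual_lattice L e0 by move=> x [x1 _]; rewrite e0E.
have e0nz : e0 != 0.
  apply/eqP => e00; have := e0E ((1 : R^o), (0 : V)).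
  by rewrite e00 lfunE /= => /esym/eqP; rewrite oner_eq0.
have e0P p : P p -> -1 <= (e0 p : R) <= 1 by move=> /Pstrip []; rewrite e0E.
have F0 y : fine_interior L P y -> (e0 y : R) = 0.
  move=> Fy; have y1 := Fy e0 e0L e0nz.
  have := Fy (- e0) (dual_latticeN e0L); rewrite oppr_eq0 homN => /(_ e0nz) y2.
  have m1 : -1 <= Min P e0 by apply: le_Min => // p /e0P /andP[].
  have m2 : -1 <= Min P (- e0).
    by apply: le_Min => // p /e0P /andP[_]; rewrite homN lerN2.
  lra.
split; first by move=> y /F0; rewrite e0E.
have [I [n [nL bnd FE]]] := fine_interior_polyhedron Llat Ppoly.
split=> //.
  rewrite FE; apply: polyhedron_polytope => //; rewrite -FE.
  by have [x [_ [Fx _ _ _]]] := Fdim; exists x.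
move=> y yv; have [Fy yker] : basic n (fun i => Min P (n i) + 1) y.
  by apply: vertex_basic => //; rewrite -FE.
rewrite -FE in Fy.
have dim3 : \dim {: (R^o * V)%type} = 3.
  by have [b bb _] := Llat; rewrite (size_basis bb).
pose D (m : 'Hom((R^o * V)%type, R^o)) := dual_lattice L m /\ Min P m + 1 = m y.
have [w yw|n1 [n2 [[n1L n1y] [n2L n2y] spanE]]] := dual_basis3 (D := D) dim3 e0nz.
  by apply: yker => i yi; apply: yw; split=> //; case: (nL i).
have [l [e [_ el Lint]]] := lattice_coordinates Llat.
rewrite /half_lattice /=; apply/Lint => j.
have ejL : dual_lattice L (e j) by move=> x /Lint.
have [t [a [b ejE]]] := spanE (e j).
have := half_integral_value Ppoly Pvert e0L e0P Fy (F0 y Fy) n1L n1y n2L n2y ejL ejE.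
by rewrite !mulr2n homD.
Qed.
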